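(* Let $(E,\mathcal{L})$ be a left-resolving labelled graph with no sources and no sinks such that $(E,\mathcal{L},\mathcal{E}^{0,-})$ is a set-finite and receiver set-finite labelled space. With $(1-\Phi):\mathbb{Z}(\Omega)\to\mathbb{Z}(\Omega)$, $(1-\Phi)_\ell:\mathbb{Z}(\Omega_\ell)\to\mathbb{Z}(\Omega_{\ell+1})$, $(i_\ell)_*:\ker(1-\Phi)_\ell\to\ker(1-\Phi)_{\ell+1}$ and $\tilde{i}_\ell:\operatorname{coker}(1-\Phi)_\ell\to\operatorname{coker}(1-\Phi)_{\ell+1}$ ($\ell\ge1$) as defined in the context, we have $$\ker(1-\Phi)\cong\varinjlim\bigl(\ker(1-\Phi)_\ell,(i_\ell)_*\bigr),\qquad \operatorname{coker}(1-\Phi)\cong\varinjlim\bigl(\operatorname{coker}(1-\Phi)_\ell,\tilde{i}_\ell\bigr).$$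
   Context: A directed graph $E=(E^0,E^1,r,s)$ consists of sets $E^0$ (vertices), $E^1$ (edges) and maps $r,s:E^1\to E^0$. A path of length $n\ge 1$ is a sequence $\lambda=\lambda_1\cdots\lambda_n$ of edges with $r(\lambda_i)=s(\lambda_{i+1})$; $s(\lambda)=s(\lambda_1)$, $r(\lambda)=r(\lambda_n)$; $E^n$ is the set of paths of length $n$, $E^*=\bigcup_{n\ge 1}E^n$. No sources means every vertex receives an edge; no sinks means every vertex emits an edge. A labelled graph $(E,\mathcal{L})$ over a countable alphabet $\mathcal{A}$ is a directed graph with a surjective map $\mathcal{L}:E^1\to\mathcal{A}$, extended to paths by $\mathcal{L}(e_1\cdots e_n)=\mathcal{L}(e_1)\cdots\mathcal{L}(e_n)$; $\mathcal{L}^*(E)=\bigcup_{n\ge1}\mathcal{L}(E^n)$. It is left-resolving if for all $v\in E^0$ the map $\mathcal{L}:r^{-1}(v)\to\mathcal{A}$ is injective. For $\alpha\in\mathcal{L}^*(E)$ and $A\subseteq E^0$: $r(\alpha)=\{r(\lambda):\lambda\in E^*,\ \mathcal{L}(\lambda)=\alpha\}$, $r(A,\alpha)=\{r(\lambda):\lambda\in E^*,\ \mathcal{L}(\lambda)=\alpha,\ s(\lambda)\in A\}$, $\mathcal{L}(AE^1)=\{\mathcal{L}(e):e\in E^1,\ s(e)\in A\}$. A collection $\mathcal{B}\subseteq 2^{E^0}$ is accommodating if $r(\alpha)\in\mathcal{B}$ and $r(A,\alpha)\in\mathcal{B}$ for all $A\in\mathcal{B}$, $\alpha\in\mathcal{L}^*(E)$,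 and $\mathcal{B}$ is closed under finite intersections and unions; then $(E,\mathcal{L},\mathcal{B})$ is a labelled space. $\mathcal{E}^{0,-}$ is the smallest accommodating collection closed under relative complements containing all $r(\alpha)$, $\alpha\in\mathcal{L}^*(E)$, and all $\{v\}$ with $v$ a sink (here there are none). $(E,\mathcal{L},\mathcal{B})$ is set-finite if $\mathcal{L}(AE^1)$ is finite for all $A\in\mathcal{B}$, and receiver set-finite if for all $A\in\mathcal{B}$ and $\ell\ge1$ the set $\{\mathcal{L}(\lambda):\lambda\in E^\ell,\ r(\lambda)\in A\}$ is finite. For $v\in E^0$, $\ell\ge1$ let $\Lambda_\ell(v)=\{\alpha\in\mathcal{L}(E^k):k\le\ell,\ v\in r(\alpha)\}$; $v\sim_\ell w$ iff $\Lambda_\ell(v)=\Lambda_\ell(w)$; $[v]_\ell$ is the $\sim_\ell$-class of $v$; $\Omega_\ell=\{[v]_\ell:v\in E^0\}$, $\Omega=\bigcup_{\ell\ge1}\Omega_\ell$. Each $[v]_\ell$ is a finite disjoint union $\bigcup_{j=1}^m[w_j]_{\ell+1}$ with $w_j\in[v]_\ell$. Let $\chi_A$ be the characteristic function of $A\subseteq E^0$, and within the group of functions $E^0\to\mathbb{Z}$ set $\mathbb{Z}(\Omega)=\operatorname{span}_{\mathbb{Z}}\{\chi_{[v]_\ell}:[v]_\ell\in\Omega\}$ and $\mathbb{Z}(\Omega_\ell)=\operatorname{span}_{\mathbb{Z}}\{\chi_{[v]_\ell}:[v]_\ell\in\Omega_\ell\}$. The linear map $i_\ell:\mathbb{Z}(\Omega_\ell)\to\mathbb{Z}(\Omega_{\ell+1})$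 is $i_\ell(\chi_{[v]_\ell})=\sum_{j=1}^m\chi_{[w_j]_{\ell+1}}$ where $[v]_\ell=\bigcup_{j=1}^m[w_j]_{\ell+1}$ (disjoint). Linear maps are defined by $$(1-\Phi)_\ell(\chi_{[v]_\ell})=i_\ell(\chi_{[v]_\ell})-\sum_{a\in\mathcal{L}([v]_\ell E^1)}\chi_{r([v]_\ell,a)},\qquad (1-\Phi)(\chi_{[v]_\ell})=\chi_{[v]_\ell}-\sum_{a\in\mathcal{L}([v]_\ell E^1)}\chi_{r([v]_\ell,a)},$$ $(1-\Phi)_\ell:\mathbb{Z}(\Omega_\ell)\to\mathbb{Z}(\Omega_{\ell+1})$ and $(1-\Phi):\mathbb{Z}(\Omega)\to\mathbb{Z}(\Omega)$. One has $(1-\Phi)_{\ell+1}\circ i_\ell=i_{\ell+1}\circ(1-\Phi)_\ell$; $(i_\ell)_*$ is the restriction of $i_\ell$ to $\ker(1-\Phi)_\ell$, and $\tilde{i}_\ell:\operatorname{coker}(1-\Phi)_\ell\to\operatorname{coker}(1-\Phi)_{\ell+1}$ is induced by $i_{\ell+1}:\mathbb{Z}(\Omega_{\ell+1})\to\mathbb{Z}(\Omega_{\ell+2})$, where $\operatorname{coker}(1-\Phi)_\ell=\mathbb{Z}(\Omega_{\ell+1})/\operatorname{Im}(1-\Phi)_\ell$. *)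

(* Defs.v *)
Set Warnings "-redundant-canonical-projection".
From HB Require Import structures.
From mathcomp Require Import all_boot all_order all_algebra.
From mathcomp Require Import generic_quotient ring_quotient finmap.
From mathcomp Require Import all_classical.

Set Implicit Arguments.
Unset Strict Implicit.
Unset Printing Implicit Defensive.
Import Order.TTheory GRing.Theory Num.Theory.
Local Open Scope classical_set_scope.
Local Open Scope ring_scope.
Local Open Scope quotient_scope.

Definition zisomorphic (U V : zmodType) : Prop :=
  exists f : {additive U -> V}, bijective f.

Section Kernel.
Variables (U V : zmodType) (f : {additive U -> V}).

Definition zker_pred : {pred U} := [pred x | f x == 0].

Lemma zker_pred_closed : zmod_closed zker_pred.
Proof.
split=> [|x y]; rewrite !inE ?raddf0 // => /eqP fx /eqP fy.
by rewrite raddfB fx fy subrr.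
Qed.

HB.instance Definition _ := GRing.isZmodClosed.Build U zker_pred zker_pred_closed.

Record zker : Type := ZKer { zker_val :> U; zker_valP : zker_val \in zker_pred }.

HB.instance Definition _ := [isSub for zker_val].
HB.instance Definition _ := [Choice of zker by <:].
HB.instance Definition _ := [SubChoice_isSubZmodule of zker by <:].

End Kernel.

Section Cokernel.
Variables (U V : zmodType) (f : {additive U -> V}).

Definition zimg_pred : {pred V} := [pred y | `[< exists x, f x = y >]].

Lemma zimg_pred_closed : zmod_closed zimg_pred.
Proof.
split=> [|x y]; first by apply/asboolP; exists 0; rewrite raddf0.
move=> /asboolP[a fa] /asboolP[b fb]; apply/asboolP; exists (a - b).
by rewrite raddfB fa fb.
Qed.

HB.instance Definition _ := GRing.isZmodClosed.Build V zimg_pred zimg_pred_closed.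

Definition zcoker : Type := Quotient.quot zimg_pred.
HB.instance Definition _ := GRing.Zmodule.on zcoker.

Definition zcoker_pi (y : V) : zcoker := (\pi_(Quotient.quot zimg_pred) y)%qT.

End Cokernel.

Section Functoriality.
Variables (U V U' V' : zmodType) (f : {additive U -> V}) (f' : {additive U' -> V'}).
Variables (g : {additive U -> U'}) (h : {additive V -> V'}).
Hypothesis comm : forall x, f' (g x) = h (f x).

Lemma zker_map_subproof (x : zker f) : g (zker_val x) \in zker_pred f'.
Proof. by case: x => x /=; rewrite !inE comm => /eqP->; rewrite raddf0. Qed.

Definition zker_map_fun (x : zker f) : zker f' := ZKer (zker_map_subproof x).

Lemma zker_map_is_additive : zmod_morphism zker_map_fun.
Proof. by move=> x y; apply: val_inj; rewrite /= !raddfB. Qed.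

HB.instance Definition _ :=
  GRing.isZmodMorphism.Build (zker f) (zker f') zker_map_fun zker_map_is_additive.

Definition zker_map : {additive zker f -> zker f'} := zker_map_fun.

Definition zcoker_map_fun (y : zcoker f) : zcoker f' :=
  zcoker_pi f' (h (repr (y : Quotient.quot (zimg_pred f)))).

Lemma zcoker_pi_eq (W W' : zmodType) (k : {additive W -> W'}) (y z : W') :
  (zcoker_pi k y = zcoker_pi k z) <-> exists x, k x = y - z.
Proof.
rewrite /zcoker_pi; split.
  by move=> /eqP; rewrite -Quotient.idealrBE => /asboolP.
by move=> H; apply/eqP; rewrite -Quotient.idealrBE; apply/asboolP.
Qed.

Lemma zcoker_map_pi (y : V) : zcoker_map_fun (zcoker_pi f y) = zcoker_pi f' (h y).
Proof.
apply/zcoker_pi_eq.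
have /zcoker_pi_eq[x fx] : zcoker_pi f (repr (zcoker_pi f y : Quotient.quot (zimg_pred f)))
    = zcoker_pi f y by rewrite /zcoker_pi reprK.
by exists (g x); rewrite comm fx raddfB.
Qed.

Lemma zcoker_map_is_additive : zmod_morphism zcoker_map_fun.
Proof.
have piB (W W' : zmodType) (k : {additive W -> W'}) y z :
    zcoker_pi k (y - z) = zcoker_pi k y - zcoker_pi k z :> zcoker k.
  by rewrite /zcoker_pi raddfB.
move=> x y; rewrite -[x]reprK -[y]reprK -!/(zcoker_pi f _) -piB !zcoker_map_pi.
by rewrite raddfB piB.
Qed.

HB.instance Definition _ :=
  GRing.isZmodMorphism.Build (zcoker f) (zcoker f') zcoker_map_fun zcoker_map_is_additive.

Definition zcoker_map : {additive zcoker f -> zcoker f'} := zcoker_map_fun.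

End Functoriality.

(* The direct limit of M 0 -> M 1 -> ... as the disjoint union of the M n modulo
   eventual equality. *)
Section DirectLimit.
Variables (M : nat -> zmodType) (phi : forall n, {additive M n -> M n.+1}).

Let T := {n : nat & M n}.

Definition dl_step (x : T) : T := Tagged M (phi (tag x) (tagged x)).

Definition dl_equiv (x y : T) : bool :=
  `[< exists i j, iter i dl_step x = iter j dl_step y >].

Lemma dl_equiv_class : equiv_class_of dl_equiv.
Proof.
split=> [x|x y|y x z]; first by apply/asboolP; exists 0%N, 0%N.
  by apply/asboolP/asboolP => -[i [j e]]; exists j, i.
move=> /asboolP[i [j e]] /asboolP[k [l e']]; apply/asboolP.
by exists (k + i)%N, (j + l)%N; rewrite iterD e -iterD addnC !iterD e'.
Qed.

Canonical dl_equiv_equiv := EquivRelPack dl_equiv_class.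
Canonical dl_equiv_enc := defaultEncModRel dl_equiv.

Definition dirlim : Type := {eq_quot dl_equiv}.
HB.instance Definition _ : EqQuotient T dl_equiv dirlim := EqQuotient.on dirlim.
HB.instance Definition _ := Choice.on dirlim.

Definition dl_in n (x : M n) : dirlim := (\pi_dirlim (Tagged M x))%qT.

Lemma dl_in_step n (x : M n) : dl_in (phi n x) = dl_in x.
Proof.
by apply/eqP; rewrite /dl_in piE; apply/asboolP; exists 0%N, 1%N.
Qed.

Lemma dl_inE n m (x : M n) (y : M m) :
  dl_in x = dl_in y <->
  exists i j, iter i dl_step (Tagged M x) = iter j dl_step (Tagged M y).
Proof.
split=> [/eqP|H]; first by rewrite /dl_in piE => /asboolP.
by apply/eqP; rewrite /dl_in piE; apply/asboolP.
Qed.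

Fixpoint dl_shift n (x : M n) (m : nat) : M (m + n) :=
  if m is m'.+1 then phi (m' + n) (dl_shift x m') else x.

Lemma dl_shiftE n (x : M n) m : iter m dl_step (Tagged M x) = Tagged M (dl_shift x m).
Proof. by elim: m => //= m ->. Qed.

Lemma dl_shiftD n (x y : M n) m : dl_shift (x + y) m = dl_shift x m + dl_shift y m.
Proof. by elim: m => //= m ->; rewrite raddfD. Qed.

Lemma dl_in_shift n (x : M n) m : dl_in (dl_shift x m) = dl_in x.
Proof. by elim: m => //= m <-; rewrite dl_in_step. Qed.

Lemma dl_TaggedD p q (a b : M p) (a' b' : M q) :
  Tagged M a = Tagged M a' -> Tagged M b = Tagged M b' ->
  Tagged M (a + b) = Tagged M (a' + b').
Proof.
move=> ea eb; have epq : p = q by have := congr1 tag ea.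
case: q / epq a' b' ea eb => a' b' /eqP ea /eqP eb.
by move: ea eb; rewrite !eq_Tagged /= => /eqP-> /eqP->.
Qed.

Lemma dl_inD n m (x y : M n) (x' y' : M m) :
  dl_in x = dl_in x' -> dl_in y = dl_in y' -> dl_in (x + y) = dl_in (x' + y').
Proof.
move=> /dl_inE[i [j exx]] /dl_inE[k [l eyy]]; apply/dl_inE.
have e1 : (i + n = j + m)%N by move: (congr1 tag exx); rewrite !dl_shiftE.
have e2 : (k + n = l + m)%N by move: (congr1 tag eyy); rewrite !dl_shiftE.
have e3 : (i + l = k + j)%N.
  apply/eqP; rewrite -(eqn_add2r m) -addnA -e2 -[(k + j + m)%N]addnA -e1.
  by rewrite addnCA.
exists (k + i)%N, (k + j)%N; rewrite !dl_shiftE !dl_shiftD; apply: dl_TaggedD.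
  by rewrite -!dl_shiftE !iterD exx.
by rewrite -!dl_shiftE -e3 addnC !iterD eyy.
Qed.

Lemma dl_in_cast p q (e : p = q) (x : M p) :
  dl_in (eq_rect p (fun k => M k) x q e) = dl_in x.
Proof. by case: q / e. Qed.

Lemma dl_in_lift n (x : M n) N : (n <= N)%N -> exists y : M N, dl_in y = dl_in x.
Proof.
move=> nN; exists (eq_rect _ (fun k => M k) (dl_shift x (N - n)) _ (subnK nN)).
by rewrite dl_in_cast dl_in_shift.
Qed.

Lemma dl_in_surj (a : dirlim) : exists n (x : M n), a = dl_in x.
Proof. by exists (tag (repr a)), (tagged (repr a)); rewrite /dl_in taggedK reprK. Qed.

Lemma dl_in3 (a b c : dirlim) :
  exists n (x y z : M n), [/\ a = dl_in x, b = dl_in y & c = dl_in z].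
Proof.
have [p [x ->]] := dl_in_surj a; have [q [y ->]] := dl_in_surj b.
have [r [z ->]] := dl_in_surj c; exists (p + q + r)%N.
have [x' <-] := dl_in_lift x (leq_trans (leq_addr q p) (leq_addr r _)).
have [y' <-] := dl_in_lift y (leq_trans (leq_addl p q) (leq_addr r _)).
have [z' <-] := dl_in_lift z (leq_addl (p + q) r).
by exists x', y', z'.
Qed.

Definition dl_zero : dirlim := dl_in (0 : M 0).

Definition dl_opp (a : dirlim) : dirlim := dl_in (- tagged (repr a)).

Definition dl_add (a b : dirlim) : dirlim :=
  let u := repr a in let v := repr b in
  let cast := eq_rect _ (fun k => M k) (dl_shift (tagged v) (tag u)) _ (addnC _ _) in
  dl_in (dl_shift (tagged u) (tag v) + cast).

Lemma dl_addE n (x y : M n) : dl_add (dl_in x) (dl_in y) = dl_in (x + y).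
Proof.
have in_repr (a : dirlim) : dl_in (tagged (repr a)) = a.
  by rewrite /dl_in taggedK reprK.
apply: dl_inD; first by rewrite dl_in_shift in_repr.
by rewrite dl_in_cast dl_in_shift in_repr.
Qed.

Lemma dl_zeroE n : dl_zero = dl_in (0 : M n).
Proof.
have shift0 m : dl_shift (0 : M 0) m = 0 by elim: m => //= m ->; rewrite raddf0.
by rewrite /dl_zero -(dl_in_shift _ n) shift0 addn0.
Qed.

Lemma dl_oppE n (x : M n) : dl_opp (dl_in x) = dl_in (- x).
Proof.
have shiftN p (z : M p) m : dl_shift (- z) m = - dl_shift z m.
  by elim: m => //= m ->; rewrite raddfN.
have /dl_inE[i [j e]] : dl_in (tagged (repr (dl_in x))) = dl_in x.
  by rewrite {1}/dl_in taggedK reprK.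
apply/dl_inE; exists i, j; move: e; rewrite !dl_shiftE !shiftN.
move: (dl_shift _ i) (dl_shift _ j) => a b e.
have epq : (i + tag (repr (dl_in x)) = j + n)%N := congr1 tag e.
by case: _ / epq b e => b /eqP; rewrite eq_Tagged => /eqP /= ->.
Qed.

Lemma dl_addA : associative dl_add.
Proof. by move=> a b c; have [n [x [y [z [-> -> ->]]]]] := dl_in3 a b c; rewrite !dl_addE addrA. Qed.

Lemma dl_addC : commutative dl_add.
Proof. by move=> a b; have [n [x [y [z [-> -> _]]]]] := dl_in3 a b b; rewrite !dl_addE addrC. Qed.

Lemma dl_add0 : left_id dl_zero dl_add.
Proof. by move=> a; have [n [x ->]] := dl_in_surj a; rewrite (dl_zeroE n) dl_addE add0r. Qed.

Lemma dl_addN : left_inverse dl_zero dl_opp dl_add.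
Proof.
by move=> a; have [n [x ->]] := dl_in_surj a; rewrite (dl_zeroE n) dl_oppE dl_addE addNr.
Qed.

HB.instance Definition _ := GRing.isZmodule.Build dirlim dl_addA dl_addC dl_add0 dl_addN.

Lemma dl_in_is_additive n : zmod_morphism (@dl_in n).
Proof.
move=> x y.
by rewrite -[RHS]/(dl_add (dl_in x) (dl_opp (dl_in y))) dl_oppE dl_addE.
Qed.

HB.instance Definition _ n :=
  GRing.isZmodMorphism.Build (M n) dirlim (@dl_in n) (@dl_in_is_additive n).

End DirectLimit.
Section Span.
Variables (U : zmodType) (S : set U).

Definition zspan_pred : {pred U} :=
  [pred x | `[< exists s : seq (U * int),
    (forall p, p \in s -> S p.1) /\ x = \sum_(p <- s) p.1 *~ p.2 >]].

Lemma zspan_pred_closed : zmod_closed zspan_pred.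
Proof.
split=> [|x y]; first by apply/asboolP; exists [::]; rewrite big_nil.
move=> /asboolP[s [Ss ->]] /asboolP[t [St ->]]; apply/asboolP.
exists (s ++ [seq (p.1, - p.2) | p <- t]); split=> [p|].
  by rewrite mem_cat => /orP[/Ss//|/mapP[q /St ? ->]].
by rewrite big_cat big_map -sumrN; congr (_ + _); apply: eq_bigr => p _; rewrite mulrNz.
Qed.

HB.instance Definition _ := GRing.isZmodClosed.Build U zspan_pred zspan_pred_closed.

Record zspan : Type := ZSpan { zspan_val :> U; zspan_valP : zspan_val \in zspan_pred }.

HB.instance Definition _ := [isSub for zspan_val].
HB.instance Definition _ := [Choice of zspan by <:].
HB.instance Definition _ := [SubChoice_isSubZmodule of zspan by <:].

Lemma zspan_gen (u : U) : S u -> u \in zspan_pred.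
Proof.
move=> Su; apply/asboolP; exists [:: (u, 1)]; rewrite big_seq1; split=> // p.
by rewrite inE => /eqP->.
Qed.

Lemma zspan_uniq (W : zmodType) (f g : {additive zspan -> W}) :
  (forall x, S (zspan_val x) -> f x = g x) -> f =1 g.
Proof.
move=> fg [x xS]; have [s [Ss xE]] := asboolW xS.
elim: s x xS Ss xE => [|p s IH] x xS Ss xE.
  by have -> : ZSpan xS = 0 by [apply: val_inj; rewrite /= xE big_nil]; rewrite !raddf0.
have pS : S p.1 by apply: Ss; rewrite mem_head.
have sS : \sum_(q <- s) q.1 *~ q.2 \in zspan_pred.
  by apply/asboolP; exists s; split=> // q qs; apply: Ss; rewrite inE qs orbT.
have -> : ZSpan xS = ZSpan (zspan_gen pS) *~ p.2 + ZSpan sS.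
  by apply: val_inj; rewrite raddfD raddfMz /= xE big_cons.
rewrite !raddfD !raddfMz (fg (ZSpan _) pS) (IH _ sS) // => q qs.
by apply: Ss; rewrite inE qs orbT.
Qed.

End Span.

Lemma zspan_valE (U U' : zmodType) (S : set U) (S' : set U') (D : {additive U -> U'})
    (f : {additive zspan S -> zspan S'}) :
  (forall x, S (zspan_val x) -> zspan_val (f x) = D (zspan_val x)) ->
  forall x, zspan_val (f x) = D (zspan_val x).
Proof.
move=> fD; pose v : {additive zspan S -> U} := \val.
pose v' : {additive zspan S' -> U'} := \val.
exact: (@zspan_uniq _ S U' (v' \o f) (D \o v)).
Qed.

Lemma zspan_ext (U U' : zmodType) (S : set U) (S' : set U') (D : {additive U -> U'}) :
  (forall u, S u -> D u \in zspan_pred S') ->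
  exists f : {additive zspan S -> zspan S'},
    forall x, zspan_val (f x) = D (zspan_val x).
Proof.
move=> DS.
have DP (x : zspan S) : D (zspan_val x) \in zspan_pred S'.
  case: x => x /= /asboolP[s [Ss ->]]; rewrite raddf_sum big_seq rpred_sum // => p /Ss Sp.
  by rewrite raddfMz rpredMz // DS.
pose f x := ZSpan (DP x).
have fB : zmod_morphism f by move=> x y; apply: val_inj; rewrite /= !raddfB.
by exists (HB.pack_for {additive zspan S -> zspan S'} f
  (GRing.isZmodMorphism.Build _ _ f fB)).
Qed.

Record digraph := Digraph {
  vertex : choiceType;
  edge : choiceType;
  src : edge -> vertex;
  rng : edge -> vertex }.

Record labelled_graph (A : countType) := LabelledGraph {
  graph_of :> digraph;
  lab : edge graph_of -> A;
  lab_surj : forall a, exists e, lab e = a }.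

(* Paths have length at least 1, hence an explicit first edge. *)
Record gpath (E : digraph) := GPath {
  phead : edge E;
  ptail : seq (edge E);
  gpathP : path (fun e f => rng e == src f) phead ptail }.

Section Paths.
Variables (E : digraph) (l : gpath E).
Definition pedges : seq (edge E) := phead l :: ptail l.
Definition plen : nat := size pedges.
Definition psrc : vertex E := src (phead l).
Definition prng : vertex E := rng (last (phead l) (ptail l)).
End Paths.

Definition no_sources (E : digraph) := forall v : vertex E, exists e : edge E, rng e = v.
Definition no_sinks (E : digraph) := forall v : vertex E, exists e : edge E, src e = v.
Definition sink (E : digraph) (v : vertex E) := ~ exists e : edge E, src e = v.

Section LabelledGraph.
Variables (A : countType) (G : labelled_graph A).
Local Notation V := (vertex G).
Implicit Types (B C : set V) (a : A) (w : seq A).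

Definition plab (l : gpath G) : seq A := map (@lab _ G) (pedges l).

Definition words_of_len (k : nat) : set (seq A) :=
  [set w | exists2 l : gpath G, plen l = k & plab l = w].

Definition words : set (seq A) := [set w | exists l : gpath G, plab l = w].

Definition word_range w : set V := [set v | exists2 l : gpath G, plab l = w & prng l = v].

Definition rel_range B w : set V :=
  [set v | exists2 l : gpath G, plab l = w /\ B (psrc l) & prng l = v].

Definition out_labels B : set A := [set a | exists2 e : edge G, lab e = a & B (src e)].

Definition left_resolving := forall e f : edge G, rng e = rng f -> lab e = lab f -> e = f.

Definition accommodating (F : set (set V)) : Prop :=
  [/\ forall w, words w -> F (word_range w),
      forall B w, F B -> words w -> F (rel_range B w),
      setI_closed F & setU_closed F].

Definition relative_complement_closed (F : set (set V)) : Prop :=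
  forall B C, F B -> F C -> F (B `\` C).

Definition E0minus : set (set V) :=
  smallest (fun F => accommodating F /\ relative_complement_closed F)
    ([set word_range w | w in words] `|` [set [set v] | v in @sink G]).

Definition set_finite (F : set (set V)) : Prop :=
  forall B, F B -> finite_set (out_labels B).

Definition receiver_set_finite (F : set (set V)) : Prop :=
  forall B k, F B -> (1 <= k)%N ->
    finite_set [set w | exists l : gpath G, [/\ plen l = k, B (prng l) & plab l = w]].

Record standing_hypotheses : Prop := StandingHypotheses {
  sh_left_resolving : left_resolving;
  sh_no_sources : no_sources G;
  sh_no_sinks : no_sinks G;
  sh_set_finite : set_finite E0minus;
  sh_receiver_set_finite : receiver_set_finite E0minus }.

Definition Lambda (l : nat) (v : V) : set (seq A) :=
  [set w | exists2 k, (k <= l)%N & words_of_len k w /\ word_range w v].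

(* The class [v]_l of v for ~_l. *)
Definition gen_vertex (l : nat) (v : V) : set V := [set u | Lambda l v = Lambda l u].

Definition Omega_ (l : nat) : set (set V) := [set gen_vertex l v | v in [set: V]].

Definition Omega : set (set V) := \bigcup_(l in [set l | (1 <= l)%N]) Omega_ l.

Definition chi B : V -> int := fun v => ((v \in B) : nat)%:Z.

Definition ZOmega : Type := zspan [set chi C | C in Omega].
Definition ZOmega_ (l : nat) : Type := zspan [set chi C | C in Omega_ l].
HB.instance Definition _ := GRing.Zmodule.on ZOmega.
HB.instance Definition _ l := GRing.Zmodule.on (ZOmega_ l).


(* The finitely supported sums below range over finite sets under
   [standing_hypotheses]: see [finite_Omega_sub] and [sh_set_finite]. *)
Definition incl_val (l : nat) B : V -> int :=
  \sum_(C \in [set C | Omega_ l.+1 C /\ C `<=` B]) chi C.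

Definition is_incl (l : nat) (f : {additive ZOmega_ l -> ZOmega_ l.+1}) : Prop :=
  forall (v : V) (x : ZOmega_ l), zspan_val x = chi (gen_vertex l v) ->
    zspan_val (f x) = incl_val l (gen_vertex l v).

Definition is_one_minus_Phi_ (l : nat) (f : {additive ZOmega_ l -> ZOmega_ l.+1}) : Prop :=
  forall (v : V) (x : ZOmega_ l), zspan_val x = chi (gen_vertex l v) ->
    zspan_val (f x) = incl_val l (gen_vertex l v)
      - \sum_(a \in out_labels (gen_vertex l v)) chi (rel_range (gen_vertex l v) [:: a]).

Definition is_one_minus_Phi (f : {additive ZOmega -> ZOmega}) : Prop :=
  forall (l : nat) (v : V) (x : ZOmega), (1 <= l)%N ->
    zspan_val x = chi (gen_vertex l v) ->
    zspan_val (f x) = chi (gen_vertex l v)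
      - \sum_(a \in out_labels (gen_vertex l v)) chi (rel_range (gen_vertex l v) [:: a]).

Hypothesis HG : standing_hypotheses.

Lemma plab_words (l : gpath G) : words (plab l). Proof. by exists l. Qed.

Lemma range_words w v : word_range w v -> words w.
Proof. by case=> l <- _; exists l. Qed.

Lemma range1 (a : A) v : word_range [:: a] v <-> exists2 e : edge G, lab e = a & rng e = v.
Proof.
split=> [[[x [|y p] lP]] //= [<-] <-|[e <- <-]]; first by exists x.
by exists (@GPath G e [::] isT).
Qed.

Lemma rel_range1 B (a : A) v :
  rel_range B [:: a] v <-> exists e : edge G, [/\ lab e = a, B (src e) & rng e = v].
Proof.
split=> [[[x [|y p] lP] [//= [<-] Bx] <-]|[e [<- Be <-]]]; first by exists x.
by exists (@GPath G e [::] isT).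
Qed.

Lemma range_rcons w (a : A) v : words w ->
  word_range (rcons w a) v <->
  exists e : edge G, [/\ lab e = a, rng e = v & word_range w (src e)].
Proof.
move=> ww; split.
  case=> [[x p lP]]; rewrite /plab /prng /pedges /=.
  case/lastP: p lP => [|p e] lP /=.
    by case: ww => l <-; rewrite /plab /=; case: (map _ _).
  rewrite map_rcons -rcons_cons => /rcons_inj[wE aE]; rewrite last_rcons => vE.
  exists e; split=> //; move: lP; rewrite rcons_path => /andP[lP /eqP re].
  by exists (GPath lP).
case=> e [<- <- [[x p lP] <- re]].
have lP' : path (fun e f : edge G => rng e == src f) x (rcons p e).
  by rewrite rcons_path lP /=; apply/eqP.
exists (GPath lP'); last by rewrite /prng /= last_rcons.
by rewrite /plab /= map_rcons.
Qed.

Lemma words_lenE k w : words_of_len k w <-> words w /\ size w = k.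
Proof.
split=> [[l <- <-]|[[l <-] <-]]; first by split; [exists l|rewrite size_map].
by exists l => //; rewrite size_map.
Qed.

Lemma LambdaE l v w : Lambda l v w <-> (size w <= l)%N /\ word_range w v.
Proof.
split=> [[k kl [/words_lenE[_ wk] ?]]|[wl wv]]; first by rewrite wk.
by exists (size w) => //; split=> //; apply/words_lenE; split=> //; apply: range_words wv.
Qed.

Lemma Lambda_src_sub l (e f : edge G) :
  lab e = lab f -> Lambda l.+1 (rng e) = Lambda l.+1 (rng f) ->
  Lambda l (src e) `<=` Lambda l (src f).
Proof.
move=> ef L w /LambdaE[wl we]; apply/LambdaE; split=> //.
have ww := range_words we.
have : Lambda l.+1 (rng e) (rcons w (lab e)).
  by apply/LambdaE; rewrite size_rcons; split=> //; apply/(range_rcons _ _ ww); exists e.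
rewrite L => /LambdaE[_ /(range_rcons _ _ ww)[g [gl gr gw]]].
by have <- : g = f by apply: (sh_left_resolving HG); rewrite // gl.
Qed.

Lemma gen_vertex_src l (e f : edge G) :
  lab e = lab f -> gen_vertex l.+1 (rng e) (rng f) -> gen_vertex l (src e) (src f).
Proof. by move=> ef L; apply/seteqP; split; apply: Lambda_src_sub. Qed.

Lemma gen_vertex_refl l v : gen_vertex l v v. Proof. by []. Qed.

Lemma gen_vertex_eq l v u : gen_vertex l v u -> gen_vertex l v = gen_vertex l u.
Proof. by move=> L; apply/seteqP; split=> x; rewrite /gen_vertex /= L. Qed.

Lemma gen_vertexS l v : gen_vertex l.+1 v `<=` gen_vertex l v.
Proof.
move=> u L; apply/seteqP; split=> w /LambdaE[wl wv]; apply/LambdaE; split=> //.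
  have : Lambda l.+1 v w by apply/LambdaE; split=> //; apply: leqW.
  by rewrite L => /LambdaE[].
have : Lambda l.+1 u w by apply/LambdaE; split=> //; apply: leqW.
by rewrite -L => /LambdaE[].
Qed.

Lemma E0minus_range w : words w -> E0minus (word_range w).
Proof. by move=> ww F [[[Fr _ _ _] _] _]; apply: Fr. Qed.

Lemma E0minus_rel_range B w : E0minus B -> words w -> E0minus (rel_range B w).
Proof.
by move=> EB ww F FP; move: (FP) => [[[_ Fr _ _] _] _]; apply: Fr => //; apply: EB.
Qed.

Lemma E0minusI B C : E0minus B -> E0minus C -> E0minus (B `&` C).
Proof.
move=> EB EC F FP; move: (FP) => [[[_ _ FI _] _] _].
by apply: FI; [apply: EB|apply: EC].
Qed.

Lemma E0minusD B C : E0minus B -> E0minus C -> E0minus (B `\` C).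
Proof.
move=> EB EC F FP; move: (FP) => [[_ FD] _].
by apply: FD; [apply: EB|apply: EC].
Qed.

Lemma finite_words B l : E0minus B ->
  finite_set [set w | exists2 v, B v & Lambda l v w].
Proof.
move=> EB; elim: l => [|l IH].
  apply: (sub_finite_set _ (finite_set0 _)) => w [v _ /LambdaE[]].
  by rewrite leqn0 size_eq0 => /eqP-> [p].
apply: (@sub_finite_set _ _ ([set w | exists2 v, B v & Lambda l v w] `|`
  [set w | exists p : gpath G, [/\ plen p = l.+1, B (prng p) & plab p = w]])); last first.
  by rewrite finite_setU; split=> //; apply: (sh_receiver_set_finite HG).
move=> w [v Bv /LambdaE[]]; rewrite leq_eqVlt => /orP[/eqP wl [p pw pv]|wl wv].
  by right; exists p; split=> //; rewrite ?pv // -wl -pw size_map.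
by left; exists v => //; apply/LambdaE.
Qed.

Lemma E0minus_separate (s : seq (seq A)) B v : E0minus B -> (forall w, w \in s -> words w) ->
  E0minus (B `&` [set u | forall w, w \in s -> word_range w u <-> word_range w v]).
Proof.
move=> EB; elim: s => [|w s IH] sw.
  by rewrite (_ : [set _ | _] = setT) ?setIT //; apply/seteqP; split.
have {IH}IH := IH (fun z zs => sw z (mem_behead (s := w :: s) zs)).
have Ew : E0minus (word_range w) by apply: E0minus_range; apply: sw; apply: mem_head.
set T := B `&` _ in IH.
have [wv|wv] := pselect (word_range w v).
  rewrite (_ : _ `&` _ = T `&` word_range w); first exact: E0minusI.
  apply/seteqP; split=> u /=.
    move=> [Bu H]; split; last by apply/(H w); rewrite ?mem_head.
    by split=> // z zs; apply: H; rewrite inE zs orbT.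
  by move=> [[Bu H] wu]; split=> // z; rewrite inE => /orP[/eqP->|/H].
rewrite (_ : _ `&` _ = T `\` word_range w); first exact: E0minusD.
apply/seteqP; split=> u /=.
  move=> [Bu H]; split; last by move/(H w (mem_head _ _)).
  by split=> // z zs; apply: H; rewrite inE zs orbT.
by move=> [[Bu H] wu]; split=> // z; rewrite inE => /orP[/eqP->|/H].
Qed.

Lemma E0minus_gen_vertex l v : (1 <= l)%N -> E0minus (gen_vertex l v).
Proof.
move=> l1; have [e ev] := sh_no_sources HG v.
have av : word_range [:: lab e] v by apply/range1; exists e.
have aw := range_words av; have Ea := E0minus_range aw.
have Ffin := finite_words l Ea; set F := [set w | _] in Ffin.
have H := @E0minus_separate (fset_set F) _ v Ea.
rewrite (_ : gen_vertex l v = word_range [:: lab e] `&`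
  [set u | forall w, w \in (fset_set F : seq _) -> word_range w u <-> word_range w v]).
  by apply: H => w; rewrite in_fset_set // inE => -[u _ /LambdaE[_ /range_words]].
apply/seteqP; split=> u.
  move=> L; split.
    have : Lambda l v [:: lab e] by apply/LambdaE.
    by rewrite L => /LambdaE[].
  move=> w; rewrite in_fset_set // inE => -[_ _ /LambdaE[wl _]].
  split=> wu.
    have : Lambda l u w by apply/LambdaE.
    by rewrite -L => /LambdaE[].
  have : Lambda l v w by apply/LambdaE.
  by rewrite L => /LambdaE[].
move=> [au Hu]; apply/seteqP; split=> w wv; move/LambdaE: (wv) => [wl rw];
  apply/LambdaE; split=> //; apply/(Hu w) => //; rewrite in_fset_set // inE.
  by exists v.
by exists u.
Qed.

Lemma finite_subsets (T : choiceType) (F : set T) :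
  finite_set F -> finite_set [set S | S `<=` F].
Proof.
move=> Ffin; apply: (@sub_finite_set _ _
  ((fun X : {fset T} => [set` X]) @` [set` fpowerset (fset_set F)])).
  move=> S SF; have Sfin := sub_finite_set SF Ffin.
  exists (fset_set S); last by rewrite fset_setK.
  rewrite /= fpowersetE; apply/fsubsetP => x.
  by rewrite !in_fset_set // !inE => /SF.
exact/finite_image/finite_fset.
Qed.

Lemma finite_Omega_sub l B : E0minus B -> finite_set [set C | Omega_ l C /\ C `<=` B].
Proof.
move=> EB; have := finite_words l EB; set F := [set w | _] => /finite_subsets Ffin.
apply: (@sub_finite_set _ _ ((fun S => [set u | S = Lambda l u]) @` [set S | S `<=` F])).
  move=> _ [[v _ <-] vB]; exists (Lambda l v) => // w wv.
  by exists v => //; apply: vB.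
exact: finite_image.
Qed.

Lemma fct_fsumE (I : choiceType) (P : set I) (F : I -> V -> int) v : finite_set P ->
  (\sum_(i \in P) F i) v = \sum_(i \in P) F i v.
Proof. by move=> Pfin; rewrite !fsbig_finite // fct_sumE. Qed.

Lemma chi_union l B : E0minus B ->
  (forall v, B v -> gen_vertex l v `<=` B) ->
  \sum_(C \in [set C | Omega_ l C /\ C `<=` B]) chi C = chi B.
Proof.
move=> EB sB; apply/funext => v; rewrite fct_fsumE; last exact: finite_Omega_sub.
have [Bv|Bv] := pselect (B v); last first.
  rewrite fsbig1 => [|C [_ CB]]; first by rewrite /chi memNset.
  by rewrite /chi memNset // => /CB.
rewrite (fsbigD1 (gen_vertex l v)) /=; first last.
- by split; [exists v|apply: sB].
- exact: finite_Omega_sub.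
rewrite fsbig1 => [|C [[[u _ <-] _] Cv]]; first by rewrite addr0 /chi !mem_set.
by rewrite /chi memNset // => uv; apply: Cv; apply: gen_vertex_eq.
Qed.

Lemma chi_span l B : E0minus B -> (forall v, B v -> gen_vertex l v `<=` B) ->
  chi B \in zspan_pred [set chi C | C in Omega_ l].
Proof.
move=> EB sB; rewrite -(chi_union EB sB) fsbig_finite; last exact: finite_Omega_sub.
rewrite big_seq rpred_sum // => C.
rewrite in_fset_set; last exact: finite_Omega_sub.
by rewrite inE => -[OC _]; apply: zspan_gen; exists C.
Qed.

Lemma incl_valE l v : (1 <= l)%N -> incl_val l (gen_vertex l v) = chi (gen_vertex l v).
Proof.
move=> l1; apply: chi_union; first exact: E0minus_gen_vertex.
by move=> u vu; rewrite (gen_vertex_eq vu); apply: gen_vertexS.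
Qed.

(* An explicit formula for 1 - Phi: by left resolvability, Phi f at v is the sum of
   f (src e) over the edges e into v.  It serves only to prove that the maps exist. *)
Definition Dfun (f : V -> int) : V -> int :=
  fun v => f v - \sum_(e \in [set e : edge G | rng e = v]) f (src e).

Lemma finite_in_edges v : finite_set [set e : edge G | rng e = v].
Proof.
have [e0 ev] := sh_no_sources HG v.
have av : word_range [:: lab e0] v by apply/range1; exists e0.
have Ea := E0minus_range (range_words av).
have Ffin := finite_words 1 Ea; set F := [set w | _] in Ffin.
pose h (e : edge G) : seq A := if rng e == v then [:: lab e] else [::].
apply: (@sub_finite_set _ _ (h @^-1` F)).
  move=> e /= re; rewrite /h re eqxx; exists v => //; apply/LambdaE; split=> //.
  by apply/range1; exists e.
apply: finite_preimage => // e f.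
rewrite !inE /h /=; case: eqP => re; last by move=> [? _ /LambdaE[_ []]].
move=> _; case: eqP => rf; last by move=> [? _ /LambdaE[_ []]].
by move=> _ [ef]; apply: (sh_left_resolving HG); rewrite ?re ?rf.
Qed.

Lemma Dfun_additive : zmod_morphism Dfun.
Proof.
move=> f g; apply/funext => v; rewrite /Dfun !fctE.
have fin := finite_in_edges v; rewrite !fsbig_finite // sumrB.
by rewrite !opprD !opprK !addrA; congr (_ + _); rewrite addrAC.
Qed.

HB.instance Definition _ :=
  GRing.isZmodMorphism.Build (V -> int) (V -> int) Dfun Dfun_additive.

Lemma Dfun_chi B : E0minus B ->
  Dfun (chi B) = chi B - \sum_(a \in out_labels B) chi (rel_range B [:: a]).
Proof.
move=> EB; have ofin := sh_set_finite HG EB.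
apply/funext => v; rewrite /Dfun !fctE fct_fsumE //; congr (_ - _).
transitivity (\sum_(e \in [set e : edge G | rng e = v /\ B (src e)]) (1 : int)).
  rewrite fsbig_mkcond [RHS]fsbig_mkcond; apply: eq_fsbigr => e _.
  rewrite /patch /chi; have [Be|Be] := pselect (B (src e)).
    by rewrite (mem_set Be) /=; congr (if _ then _ else _); apply/idP/idP => /set_mem;
      [move=> re|move=> [re _]]; apply/mem_set.
  rewrite (memNset Be) if_same; case: ifP => //.
  by rewrite inE => -[].
transitivity (\sum_(a \in [set a | rel_range B [:: a] v]) (1 : int)).
  rewrite -(fsbig_image (op := +%R) _ (@lab _ G) (fun=> 1 : int)); last first.
    move=> e f; rewrite !inE => -[re _] [rf _]; apply: (sh_left_resolving HG).
    by rewrite re rf.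
  congr (\big[_/_]_(_ \in _) _); apply/seteqP; split=> a /=.
    by move=> [e [re Be] <-]; apply/rel_range1; exists e.
  by move=> /rel_range1[e [<- Be re]]; exists e.
rewrite fsbig_mkcond [RHS]fsbig_mkcond; apply: eq_fsbigr => a _.
rewrite /patch /chi; have [va|va] := pselect (rel_range B [:: a] v).
  rewrite (mem_set va) !mem_set //.
  by move/rel_range1: va => [e [<- ? _]]; exists e.
by rewrite (memNset va) memNset // if_same.
Qed.

Lemma chi_gen_vertexS l v : (1 <= l)%N ->
  chi (gen_vertex l v) \in zspan_pred [set chi C | C in Omega_ l.+1].
Proof.
move=> l1; apply: chi_span; first exact: E0minus_gen_vertex.
by move=> u vu; rewrite (gen_vertex_eq vu); apply: gen_vertexS.
Qed.

Lemma Dfun_span l v : (1 <= l)%N ->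
  Dfun (chi (gen_vertex l v)) \in zspan_pred [set chi C | C in Omega_ l.+1].
Proof.
move=> l1; have Ev := E0minus_gen_vertex v l1; rewrite Dfun_chi // rpredB //.
  exact: chi_gen_vertexS.
have ofin := sh_set_finite HG Ev.
rewrite fsbig_finite // big_seq rpred_sum // => a; rewrite in_fset_set // inE => -[e ea ve].
apply: chi_span; first by apply: E0minus_rel_range => //; exists (@GPath G e [::] isT); rewrite -ea.
move=> _ /rel_range1[f [fa vf <-]] u fu.
have : word_range [:: a] u.
  have : Lambda l.+1 (rng f) [:: a] by apply/LambdaE; split=> //; apply/range1; exists f.
  by rewrite fu => /LambdaE[].
move=> /range1[g ga gu]; apply/rel_range1; exists g; split=> //.
rewrite (gen_vertex_eq vf); apply: gen_vertex_src; first by rewrite fa ga.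
by rewrite gu.
Qed.

Lemma incl_exists n : exists f : {additive ZOmega_ n.+1 -> ZOmega_ n.+2}, is_incl f.
Proof.
have [f fE] : exists f : {additive ZOmega_ n.+1 -> ZOmega_ n.+2},
    forall x, zspan_val (f x) = idfun (zspan_val x).
  by apply: zspan_ext => _ [_ [v _ <-] <-]; apply: chi_gen_vertexS.
by exists f => v x xv; rewrite fE xv incl_valE.
Qed.

Lemma one_minus_Phi__exists n :
  exists f : {additive ZOmega_ n.+1 -> ZOmega_ n.+2}, is_one_minus_Phi_ f.
Proof.
have [f fE] : exists f : {additive ZOmega_ n.+1 -> ZOmega_ n.+2},
    forall x, zspan_val (f x) = Dfun (zspan_val x).
  by apply: zspan_ext => _ [_ [v _ <-] <-]; apply: Dfun_span.
exists f => v x xv; rewrite fE xv incl_valE // Dfun_chi //.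
exact: E0minus_gen_vertex.
Qed.

Lemma one_minus_Phi_exists : exists f : {additive ZOmega -> ZOmega}, is_one_minus_Phi f.
Proof.
have [f fE] : exists f : {additive ZOmega -> ZOmega},
    forall x, zspan_val (f x) = Dfun (zspan_val x).
  apply: zspan_ext => _ [_ [l l1 [v _ <-]] <-].
  have [s [Ss sE]] := asboolW (Dfun_span v l1).
  apply/asboolP; exists s; split; last exact: sE.
  move=> p /Ss.
  by move=> [C OC <-]; exists C => //; exists l.+1.
exists f => l v x l1 xv; rewrite fE xv Dfun_chi //.
exact: E0minus_gen_vertex.
Qed.

(* The maps i_l and (1 - Phi)_l exist only for l >= 1, so [incl n] is i_{n+1} and
   [one_minus_Phi_ n] is (1 - Phi)_{n+1}.  They are the unique additive maps with the
   prescribed values on the characteristic functions ([zspan_uniq]). *)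
Definition incl n : {additive ZOmega_ n.+1 -> ZOmega_ n.+2} := projT1 (cid (incl_exists n)).
Definition one_minus_Phi_ n : {additive ZOmega_ n.+1 -> ZOmega_ n.+2} :=
  projT1 (cid (one_minus_Phi__exists n)).
Definition one_minus_Phi : {additive ZOmega -> ZOmega} := projT1 (cid one_minus_Phi_exists).

Lemma inclP n : is_incl (incl n). Proof. exact: projT2 (cid _). Qed.
Lemma one_minus_Phi_P n : is_one_minus_Phi_ (one_minus_Phi_ n).
Proof. exact: projT2 (cid _). Qed.
Lemma one_minus_PhiP : is_one_minus_Phi one_minus_Phi.
Proof. exact: projT2 (cid _). Qed.


Lemma inclE n x : zspan_val (incl n x) = zspan_val x.
Proof.
apply: (zspan_valE (D := idfun)) => y -[_ [v _ <-] /esym yv].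
by rewrite (inclP yv) yv incl_valE.
Qed.

Lemma one_minus_Phi_E n x : zspan_val (one_minus_Phi_ n x) = Dfun (zspan_val x).
Proof.
apply: zspan_valE => y -[_ [v _ <-] /esym yv].
rewrite (one_minus_Phi_P yv) yv incl_valE //.
by apply/esym/Dfun_chi; apply: E0minus_gen_vertex.
Qed.

Lemma incl_comm n x :
  one_minus_Phi_ n.+1 (incl n x) = incl n.+1 (one_minus_Phi_ n x).
Proof. by apply: val_inj; rewrite /= one_minus_Phi_E !inclE one_minus_Phi_E. Qed.

Definition ker_incl n :
    {additive zker (one_minus_Phi_ n) -> zker (one_minus_Phi_ n.+1)} :=
  zker_map (@incl_comm n).

Definition coker_incl n :
    {additive zcoker (one_minus_Phi_ n) -> zcoker (one_minus_Phi_ n.+1)} :=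
  zcoker_map (@incl_comm n).

End LabelledGraph.

(* Main.v *)
From HB Require Import structures.
From mathcomp Require Import all_classical.
Require Import Defs.
From mathcomp Require Import all_boot all_order all_algebra.

(** A class of level [l] is a finite disjoint union of classes of level [l+1], so its
    characteristic function is a sum of those of level [l+1].
    Hence, inside the group of functions from vertices to integers,
    the groups [ZOmega_ l] form an increasing sequence of subgroups with union
    [ZOmega], the maps [incl] are the inclusions, and both [one_minus_Phi] and its
    finite-level versions are restrictions of one operator [Dfun].  So
    [one_minus_Phi] is the direct limit of the maps [one_minus_Phi_ n], seen as a
    morphism between the systems [ZOmega_ n.+1] and [ZOmega_ n.+2].

    The theorem is then the exactness of sequential direct limits.  A cocone is a
    direct limit as soon as its legs are jointly surjective and an element sent to
    zero by a leg already dies in the system ([presents_zisomorphic]).  This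
    criterion passes from two systems to the kernels ([zker_presents]) and to the
    cokernels ([zcoker_presents]) of a morphism between them.  For kernels: if [x] at
    stage [n] maps into the kernel of the limit map, then [f n x] vanishes at some
    later stage, so [x] moved to that stage lies in the kernel there.  For cokernels:
    if [y] becomes a value of the limit map, that value comes from some stage, and
    the difference vanishes at a later one. *)

Set Implicit Arguments.
Unset Strict Implicit.
Unset Printing Implicit Defensive.
Import GRing.Theory.
Local Open Scope classical_set_scope.
Local Open Scope ring_scope.

(** * Recognizing sequential direct limits *)

Section Presentation.
Variables (M : nat -> zmodType) (phi : forall n, {additive M n -> M n.+1}).
Variables (W : zmodType) (tau : forall n, {additive M n -> W}).

Definition cocone : Prop := forall n (x : M n), tau n.+1 (phi n x) = tau n x.

Lemma dl_in_eq0 n (x : M n) : dl_in phi x = 0 <-> exists m, dl_shift phi x m = 0.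
Proof.
split=> [x0|[m xm0]]; last by rewrite -(dl_in_shift phi x m) xm0 raddf0.
have /dl_inE[i [j]] : dl_in phi x = dl_in phi (0 : M n) by rewrite x0 raddf0.
have shift0 k : dl_shift phi (0 : M n) k = 0 by elim: k => //= k ->; rewrite raddf0.
rewrite !dl_shiftE shift0 => e; exists i.
have ij : i = j by apply/eqP; rewrite -(eqn_add2r n); apply/eqP; exact: (congr1 tag e).
by move: e; rewrite -ij => /eqP; rewrite eq_Tagged => /eqP.
Qed.

Lemma cocone_dl_in : cocone ->
  forall n m (x : M n) (y : M m), dl_in phi x = dl_in phi y -> tau n x = tau m y.
Proof.
move=> tau_phi n m x y /dl_inE[i [j]]; rewrite !dl_shiftE => e.
have tau_shift p (z : M p) k : tau _ (dl_shift phi z k) = tau p z.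
  by elim: k => //= k <-; rewrite tau_phi.
rewrite -(tau_shift n x i) -(tau_shift m y j).
exact: (congr1 (fun t : {n & M n} => tau (tag t) (tagged t)) e).
Qed.

(** Vanishing in the system is phrased with [dl_in], which is insensitive to the
    stage and so avoids transporting along equalities of indices. *)
Definition presents : Prop :=
  [/\ cocone,
      forall w, exists n (x : M n), tau n x = w &
      forall n (x : M n), tau n x = 0 -> dl_in phi x = 0].

(** This is the injectivity of the map from the limit to [W]: lifting
    both elements to one stage reduces it to the vanishing of a difference. *)
Lemma presents_dl_in : presents ->
  forall n m (x : M n) (y : M m), tau n x = tau m y -> dl_in phi x = dl_in phi y.
Proof.
move=> [tau_phi _ tau0] n m x y xy.
have [x' x'x] := dl_in_lift phi x (leq_addr m n).
have [y' y'y] := dl_in_lift phi y (leq_addl n m).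
rewrite -x'x -y'y; apply/eqP; rewrite -subr_eq0 -raddfB; apply/eqP/tau0.
by rewrite raddfB (cocone_dl_in tau_phi x'x) (cocone_dl_in tau_phi y'y) xy subrr.
Qed.

Lemma presents_zisomorphic : presents -> zisomorphic W (dirlim phi).
Proof.
move=> Ptau; have [tau_phi tau_surj _] := Ptau.
have repP (w : W) : exists t : {n & M n}, tau (tag t) (tagged t) = w.
  by have [n [x <-]] := tau_surj w; exists (Tagged M x).
pose rep w := projT1 (cid (repP w)).
have repE w : tau _ (tagged (rep w)) = w := projT2 (cid (repP w)).
pose F w : dirlim phi := dl_in phi (tagged (rep w)).
have FE n (x : M n) : F (tau n x) = dl_in phi x.
  by apply: presents_dl_in => //; rewrite repE.
have F_additive : zmod_morphism F.
  move=> u v; have [n [x [y [_ [ux vy _]]]]] := dl_in3 (F u) (F v) 0.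
  have <- : tau n x = u by rewrite -(cocone_dl_in tau_phi ux) repE.
  have <- : tau n y = v by rewrite -(cocone_dl_in tau_phi vy) repE.
  by rewrite -raddfB !FE raddfB.
exists (HB.pack_for {additive W -> dirlim phi} F
  (GRing.isZmodMorphism.Build _ _ F F_additive)) => /=.
have unrepP (a : dirlim phi) : exists w, F w = a.
  by have [n [x ->]] := dl_in_surj a; exists (tau n x).
exists (fun a => projT1 (cid (unrepP a))) => [w|a] /=; last by case: cid.
by case: cid => v /= /(cocone_dl_in tau_phi); rewrite !repE.
Qed.

End Presentation.

(** * Exactness of sequential direct limits *)

Section Exactness.
Variables (M N : nat -> zmodType).
Variables (phi : forall n, {additive M n -> M n.+1}).
Variables (psi : forall n, {additive N n -> N n.+1}).
Variables (f : forall n, {additive M n -> N n}).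
Hypothesis f_comm : forall n x, f n.+1 (phi n x) = psi n (f n x).
Variables (W W' : zmodType) (g : {additive W -> W'}).
Variables (tau : forall n, {additive M n -> W}).
Variables (sigma : forall n, {additive N n -> W'}).
Hypothesis g_comm : forall n x, g (tau n x) = sigma n (f n x).
Hypotheses (tauP : presents phi tau) (sigmaP : presents psi sigma).

Lemma shift_comm n (x : M n) m : f _ (dl_shift phi x m) = dl_shift psi (f n x) m.
Proof. by elim: m => //= m <-; rewrite f_comm. Qed.

(** The stage of a preimage [x] of [w] is not enough: [f n x] need only vanish later
    in the second system, so [x] is pushed to the stage where it does. *)
Lemma zker_presents :
  presents (fun n => zker_map (@f_comm n)) (fun n => zker_map (@g_comm n)).
Proof.
have [tau_phi tau_surj tau0] := tauP; have [_ _ sigma0] := sigmaP.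
split=> [n x|[w gw]|n x].
- by apply: val_inj; rewrite /= tau_phi.
- have [n [x xw]] := tau_surj w.
  have /sigma0/dl_in_eq0[m fxm0] : sigma n (f n x) = 0.
    by rewrite -g_comm xw; apply/eqP.
  have kx : dl_shift phi x m \in zker_pred (f (m + n)%N).
    by rewrite inE shift_comm fxm0.
  exists (m + n)%N, (ZKer kx); apply: val_inj => /=; rewrite -xw.
  by apply: (cocone_dl_in tau_phi); rewrite dl_in_shift.
- move=> /(congr1 val) /= /tau0/dl_in_eq0[m xm0]; apply/dl_in_eq0; exists m.
  apply: val_inj; rewrite /= -xm0.
  by elim: m {xm0} => //= m ->.
Qed.

Lemma zcoker_piB (U V : zmodType) (k : {additive U -> V}) y z :
  zcoker_pi k (y - z) = zcoker_pi k y - zcoker_pi k z :> zcoker k.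
Proof. by rewrite /zcoker_pi raddfB. Qed.

Lemma zcoker_pi_eq0 (U V : zmodType) (k : {additive U -> V}) y :
  zcoker_pi k y = 0 :> zcoker k <-> exists x, k x = y.
Proof.
by rewrite -(subrr (zcoker_pi k 0 : zcoker k)) -zcoker_piB subrr zcoker_pi_eq subr0.
Qed.

Lemma zcoker_pi_surj (U V : zmodType) (k : {additive U -> V}) (c : zcoker k) :
  exists y, c = zcoker_pi k y.
Proof. by exists (generic_quotient.repr c); rewrite /zcoker_pi generic_quotient.reprK. Qed.

Lemma shift_zcoker_pi n (y : N n) m :
  dl_shift (fun n => zcoker_map (@f_comm n)) (zcoker_pi (f n) y : zcoker (f n)) m =
  zcoker_pi (f (m + n)%N) (dl_shift psi y m).
Proof. by elim: m => //= m ->; exact: (zcoker_map_pi (@f_comm _)). Qed.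

(** The class of [y] dies in the limit when [sigma n y = g (tau k x)] with [x] at an
    unrelated stage [k]; both are moved to stage [k + n] before being compared. *)
Lemma zcoker_presents :
  presents (fun n => zcoker_map (@f_comm n)) (fun n => zcoker_map (@g_comm n)).
Proof.
have [tau_phi tau_surj _] := tauP; have [sigma_psi sigma_surj sigma0] := sigmaP.
split=> [n c|c|n c].
- have [y ->] := zcoker_pi_surj c.
  by rewrite /= (zcoker_map_pi (@f_comm n)) !(zcoker_map_pi (@g_comm _)) sigma_psi.
- have [w' ->] := zcoker_pi_surj c; have [n [y <-]] := sigma_surj w'.
  exists n, (zcoker_pi (f n) y); exact: (zcoker_map_pi (@g_comm n)).
- have [y ->] := zcoker_pi_surj c; rewrite /= (zcoker_map_pi (@g_comm n)).
  move=> /zcoker_pi_eq0[w gw].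
  have [k [x xw]] := tau_surj w.
  have [x' /(cocone_dl_in tau_phi) x'x] := dl_in_lift phi x (leq_addr n k).
  rewrite -(dl_in_shift _ _ k) shift_zcoker_pi.
  (* Subtracting a value of [f] leaves the class unchanged and makes the
     representative vanish in the limit. *)
  have -> : zcoker_pi (f (k + n)%N) (dl_shift psi y k) =
            zcoker_pi (f (k + n)%N) (dl_shift psi y k - f _ x').
    by apply/zcoker_pi_eq; exists x'; rewrite opprB addrC subrK.
  have /sigma0/dl_in_eq0[m e] : sigma _ (dl_shift psi y k - f _ x') = 0.
    rewrite raddfB -g_comm x'x xw gw; apply/eqP; rewrite subr_eq0; apply/eqP.
    by apply: (cocone_dl_in sigma_psi); rewrite dl_in_shift.
  by apply/dl_in_eq0; exists m; rewrite shift_zcoker_pi e; apply/zcoker_pi_eq0; exists 0;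
    rewrite raddf0.
Qed.

End Exactness.

(** * Increasing unions of spans *)

(** The generators [T] of the union need only lie in the span of some [S n], not in
    [S n] itself: the generators of lowest level of [ZOmega] are lost in the system
    that starts one level higher. *)
Lemma zspan_presents (U : zmodType) (S : nat -> set U) (T : set U)
    (phi : forall n, {additive zspan (S n) -> zspan (S n.+1)})
    (tau : forall n, {additive zspan (S n) -> zspan T}) :
  (forall n x, zspan_val (phi n x) = zspan_val x) ->
  (forall n x, zspan_val (tau n x) = zspan_val x) ->
  (forall u, T u -> exists n, u \in zspan_pred (S n)) ->
  presents phi tau.
Proof.
move=> phiE tauE TS.
have tau_phi : cocone phi tau by move=> n x; apply: val_inj; rewrite /= !tauE phiE.
split=> // [w|n x /(congr1 (@zspan_val _ _))]; last first.
  rewrite tauE => x0; have -> : x = 0 by apply: val_inj.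
  exact: raddf0.
suff [n [x xw]] : exists n (x : zspan (S n)), zspan_val x = zspan_val w.
  by exists n, x; apply: val_inj; rewrite /= tauE.
case: w => w /= /asboolP[s [Ts ->{w}]].
elim: s Ts => [|p s IHs] Ts; first by exists 0, 0; rewrite big_nil.
have [n pn] := TS p.1 (Ts p (mem_head _ _)).
have [|m [y ys]] := IHs; first by move=> q qs; apply: Ts; rewrite inE qs orbT.
have [x' /(cocone_dl_in tau_phi)/(congr1 (@zspan_val _ _)) x'p] :=
  dl_in_lift phi (ZSpan pn) (leq_addr m n).
have [y' /(cocone_dl_in tau_phi)/(congr1 (@zspan_val _ _)) y'y] :=
  dl_in_lift phi y (leq_addl n m).
exists (n + m)%N, (x' *~ p.2 + y').
rewrite big_cons -ys; move: x'p y'y; rewrite !tauE /= => <- <-.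
by rewrite -[LHS]/(\val (x' *~ p.2 + y')) raddfD raddfMz.
Qed.

(** * The groups of a labelled graph *)

Section LabelledGraph.
Variables (A : countType) (G : labelled_graph A) (HG : standing_hypotheses G).

Lemma ZOmega_emb_exists n : exists tau : {additive ZOmega_ G n.+1 -> ZOmega G},
  forall x, zspan_val (tau x) = zspan_val x.
Proof.
apply: (zspan_ext (D := idfun)) => _ [C OC <-].
by apply: zspan_gen; exists C => //; exists n.+1.
Qed.

Definition ZOmega_emb n : {additive ZOmega_ G n.+1 -> ZOmega G} :=
  projT1 (cid (ZOmega_emb_exists n)).

Lemma ZOmega_embE n x : zspan_val (ZOmega_emb n x) = zspan_val x.
Proof. exact: (projT2 (cid (ZOmega_emb_exists n)) x). Qed.

Lemma ZOmega_presents : presents (incl HG) ZOmega_emb.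
Proof.
apply: zspan_presents; [exact: inclE|exact: ZOmega_embE|].
by move=> _ [C [[//|l] _ OC] <-]; exists l; apply: zspan_gen; exists C.
Qed.

Lemma ZOmega_presentsS :
  presents (fun n => incl HG n.+1) (fun n => ZOmega_emb n.+1).
Proof.
apply: zspan_presents => [n x|n x|]; [exact: inclE|exact: ZOmega_embE|].
move=> _ [_ [[//|l] _ [v _ <-]] <-]; exists l.
exact: (chi_gen_vertexS HG).
Qed.

Lemma one_minus_PhiE x : zspan_val (one_minus_Phi HG x) = Dfun (zspan_val x).
Proof.
(* [Dfun] is additive only because the in-edges of each vertex are finite in number,
   so its additive structure has to be supplied from the hypotheses on the graph. *)
apply: (zspan_valE (D := HB.pack_for {additive (vertex G -> int) -> (vertex G -> int)}
  (@Dfun A G) (GRing.isZmodMorphism.Build _ _ (@Dfun A G) (Dfun_additive HG)))).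
move=> y -[_ [l l1 [v _ <-]] /esym yv].
rewrite (one_minus_PhiP HG l1 yv) yv.
by apply/esym/(Dfun_chi HG); apply: (E0minus_gen_vertex HG).
Qed.

Lemma one_minus_Phi_emb n x :
  one_minus_Phi HG (ZOmega_emb n x) = ZOmega_emb n.+1 (one_minus_Phi_ HG n x).
Proof.
apply: val_inj; rewrite /= one_minus_PhiE !ZOmega_embE.
by rewrite one_minus_Phi_E.
Qed.

End LabelledGraph.

Theorem theorem6p5 (A : countType) (G : labelled_graph A) (HG : standing_hypotheses G) :
  zisomorphic (zker (one_minus_Phi HG)) (dirlim (ker_incl HG)) /\
  zisomorphic (zcoker (one_minus_Phi HG)) (dirlim (coker_incl HG)).
Proof.
have PM := ZOmega_presents HG; have PN := ZOmega_presentsS HG.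
split; apply: presents_zisomorphic.
  exact: (zker_presents (incl_comm HG) (one_minus_Phi_emb HG) PM PN).
exact: (zcoker_presents (incl_comm HG) (one_minus_Phi_emb HG) PM PN).
Qed.
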